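(* Let $S\in\mathbb R^{N\times N}$ be skew-symmetric and assume the underlying Runge-Kutta method is explicit or diagonally implicit (i.e. $a_{ij}=0$ for $j>i$). Apply the RRK method (see context), taking $K$ steps, to $y'(t)=Sy(t)$, $y(0)=y_{\rm init}$, with entropy function $\eta(y)=\tfrac12\|y\|^2$. Then the RRK method preserves time-symmetry. In particular, if adjoint RRK (see context) is applied with $\lambda_K=y_K$, $w_{k-1}=0$ and $W_k=0$ for $k=1,\dots,K$, then $\lambda_k=y_k$ for all time steps $k=0,1,\dots,K$.
   Context: Fix an $s$-stage Runge-Kutta method with real coefficients $a_{ij},b_i$ ($1\le i,j\le s$), step size $\Delta t>0$, and final time $T>0$; $\|\cdot\|$ is the Euclidean norm. ''Time-symmetry'' means that each adjoint time step reverses the corresponding forward time step. RRK (relaxation Runge-Kutta) method for $y'=Sy$ taking $K$ steps, the last one being an IDT step hitting $T$ exactly: put $h_k=\Delta t$ for $k=1,\dots,K-1$ and $h_K=\Delta t^*:=T-t_{K-1}>0$, where $t_0=0$ and $t_k=t_{k-1}+\gamma_k\Delta t$ for $k\le K-1$. Set $y_0=y_{\rm init}$ and, for $k=1,\dots,K$, $$Y_{k,i}=y_{k-1}+h_k\sum_{j=1}^s a_{ij}SY_{k,j}\ (i=1,\dots,s),\qquad y_k=y_{k-1}+\gamma_kh_k\sum_{i=1}^s b_iSY_{k,i},$$ where the relaxation parameter $\gamma_k$ is the non-zero root closest to $1$ of $r_k(\,\cdot\,;y_{k-1},Y_k)$, $Y_k=(Y_{k,1},\dots,Y_{k,s})$,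 with $$r_k(\gamma;y,Y)=\eta\Big(y+\gamma h_k\sum_{i}b_iSY_{i}\Big)-\eta(y)-\gamma h_k\sum_{i}b_i\nabla\eta(Y_{i})^\top SY_{i}$$ for $y\in\mathbb R^N$, $Y=(Y_1,\dots,Y_s)\in\mathbb R^{sN}$ independent variables. It is assumed that at each step the root $\gamma_k$ exists and that $\partial r_k/\partial\gamma\ne0$ at it. The gradients of $\gamma_k$ are defined by implicit differentiation (with $h_k$ held fixed): $$(\nabla_y\gamma_k)^\top=-\Big(\frac{\partial r_k}{\partial\gamma}\Big)^{-1}\frac{\partial r_k}{\partial y},\qquad(\nabla_Y\gamma_{k,i})^\top=-\Big(\frac{\partial r_k}{\partial\gamma}\Big)^{-1}\frac{\partial r_k}{\partial Y_i},\qquad\text{evaluated at }(\gamma_k;y_{k-1},Y_k).$$ Adjoint RRK method (about the RRK solution): given $\lambda_K\in\mathbb R^N$ and source terms $w_{k-1}\in\mathbb R^N$, $W_k=(W_{k,1},\dots,W_{k,s})\in\mathbb R^{sN}$, the first adjoint step is $$\xi_K=\Delta t^*\sum_{i}b_i(SY_{K,i})^\top\lambda_K,\qquad\Lambda_{K,i}=\Delta t^*S^\top\Big(\gamma_Kb_i\lambda_K+\sum_{j}a_{ji}\Lambda_{K,j}\Big)+\xi_K\nabla_Y\gamma_{K,i}+W_{K,i},$$ $$\lambda_{K-1}=\lambda_K+\sum_i\Lambda_{K,i}+\xi_K\nabla_y\gamma_K+w_{K-1}.$$ Put $\xi_*=\Delta t\sum_{i=1}^s\sum_{j=1}^s a_{ji}(SY_{K,i})^\top\Lambda_{K,j}$.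 For $k=K-1,\dots,1$, $$\xi_k=\Delta t\sum_ib_i(SY_{k,i})^\top\lambda_k,\qquad\Lambda_{k,i}=\Delta t\,S^\top\Big(\gamma_kb_i\lambda_k+\sum_ja_{ji}\Lambda_{k,j}\Big)+(\xi_k-\xi_* )\nabla_Y\gamma_{k,i}+W_{k,i},$$ $$\lambda_{k-1}=\lambda_k+\sum_i\Lambda_{k,i}+(\xi_k-\xi_* )\nabla_y\gamma_k+w_{k-1}.$$ All index sums and stage indices range over $1,\dots,s$. *)

(* Defs.v *)
From HB Require Import structures.
From mathcomp Require Import all_boot all_order all_algebra.
From mathcomp Require Import all_classical all_reals all_analysis.
Import Order.TTheory GRing.Theory Num.Theory.
Import numFieldNormedType.Exports.
Set Implicit Arguments.
Unset Strict Implicit.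
Unset Printing Implicit Defensive.
Local Open Scope ring_scope.

Definition dotv (R : realType) (N : nat) (u v : 'cV[R]_N) : R := (u^T *m v) 0 0.

(* The library norm on matrices is the max norm, not the Euclidean one. *)
Definition enorm (R : realType) (N : nat) (u : 'cV[R]_N) : R :=
  Num.sqrt (dotv u u).

Definition square_entropy (R : realType) (N : nat) (y : 'cV[R]_N) : R :=
  2^-1 * enorm y ^+ 2.

Definition grad (R : realType) (N : nat) (f : 'cV[R]_N -> R) (x : 'cV[R]_N) :
    'cV[R]_N :=
  \col_i 'D_(delta_mx i 0) f x.

Definition skew_symmetric (R : realType) (N : nat) (S : 'M[R]_N) : Prop :=
  S^T = - S.

Record rk_method (R : realType) (s : nat) := RKMethod {
  rka : 'M[R]_s;
  rkb : 'cV[R]_s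
}.

(* Explicit or diagonally implicit method. *)
Definition rk_lower_triangular (R : realType) (s : nat) (M : rk_method R s) :
    Prop :=
  forall i j : 'I_s, (i < j)%N -> rka M i j = 0.

Definition rk_increment (R : realType) (s N : nat) (M : rk_method R s)
    (S : 'M[R]_N) (Y : 'I_s -> 'cV[R]_N) : 'cV[R]_N :=
  \sum_i rkb M i 0 *: (S *m Y i).

(* The relaxation residual r(g; y, Y) of a step of size h; here y and the
   stages Y are independent variables. *)
Definition relax_residual (R : realType) (s N : nat) (M : rk_method R s)
    (S : 'M[R]_N) (eta : 'cV[R]_N -> R) (h g : R) (y : 'cV[R]_N)
    (Y : 'I_s -> 'cV[R]_N) : R :=
  eta (y + (g * h) *: rk_increment M S Y) - eta y
  - g * h * \sum_i rkb M i 0 * dotv (grad eta (Y i)) (S *m Y i).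

Definition relax_residual_dgamma (R : realType) (s N : nat) (M : rk_method R s)
    (S : 'M[R]_N) (eta : 'cV[R]_N -> R) (h g : R) (y : 'cV[R]_N)
    (Y : 'I_s -> 'cV[R]_N) : R :=
  derive1 (fun x : R => relax_residual M S eta h x y Y) g.

Definition nonzero_root_closest_to_1 (R : realType) (r : R -> R) (g : R) :
    Prop :=
  [/\ g != 0, r g = 0 &
      forall x, x != 0 -> r x = 0 -> `|g - 1| <= `|x - 1|].

(* Gradients, as column vectors, of the relaxation parameter by implicit
   differentiation of r(g; y, Y) = 0 with the step size h held fixed. *)
Definition grad_y_gamma (R : realType) (s N : nat) (M : rk_method R s)
    (S : 'M[R]_N) (eta : 'cV[R]_N -> R) (h g : R) (y : 'cV[R]_N)
    (Y : 'I_s -> 'cV[R]_N) : 'cV[R]_N :=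
  - (relax_residual_dgamma M S eta h g y Y)^-1
    *: grad (fun z => relax_residual M S eta h g z Y) y.

Definition grad_Y_gamma (R : realType) (s N : nat) (M : rk_method R s)
    (S : 'M[R]_N) (eta : 'cV[R]_N -> R) (h g : R) (y : 'cV[R]_N)
    (Y : 'I_s -> 'cV[R]_N) (i : 'I_s) : 'cV[R]_N :=
  - (relax_residual_dgamma M S eta h g y Y)^-1
    *: grad (fun z => relax_residual M S eta h g y
                        (fun j => if j == i then z else Y j)) (Y i).

(* Solution values y_0, y_1, ..., stages Y_1, Y_2, ... and relaxation
   parameters gamma_1, gamma_2, ...; the values at other indices, in particular
   Y_0 and gamma_0, are irrelevant. *)
Record rrk_run (R : realType) (s N : nat) := RRKRun {
  run_y : nat -> 'cV[R]_N;
  run_Y : nat -> 'I_s -> 'cV[R]_N;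
  run_gamma : nat -> R
}.

Fixpoint rrk_time (R : realType) (dt : R) (gamma : nat -> R) (k : nat) : R :=
  if k is k'.+1 then rrk_time dt gamma k' + gamma k * dt else 0.

(* The size of step k out of K: the last step is an IDT step of size
   T - t_{K-1}, all the others have size dt. *)
Definition step_size (R : realType) (dt T : R) (gamma : nat -> R)
    (K k : nat) : R :=
  if k == K then T - rrk_time dt gamma K.-1 else dt.

Definition rrk_step (R : realType) (s N : nat) (M : rk_method R s)
    (S : 'M[R]_N) (eta : 'cV[R]_N -> R) (h : R) (y : 'cV[R]_N)
    (Y : 'I_s -> 'cV[R]_N) (g : R) (y' : 'cV[R]_N) : Prop :=
  [/\ forall i, Y i = y + h *: \sum_j rka M i j *: (S *m Y j),
      nonzero_root_closest_to_1
        (fun x => relax_residual M S eta h x y Y) g,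
      relax_residual_dgamma M S eta h g y Y != 0 &
      y' = y + (g * h) *: rk_increment M S Y].

Definition is_rrk_solution (R : realType) (s N : nat) (M : rk_method R s)
    (S : 'M[R]_N) (eta : 'cV[R]_N -> R) (dt T : R) (K : nat)
    (yinit : 'cV[R]_N) (u : rrk_run R s N) : Prop :=
  [/\ run_y u 0%N = yinit,
      0 < step_size dt T (run_gamma u) K K &
      forall k, (1 <= k <= K)%N ->
        rrk_step M S eta (step_size dt T (run_gamma u) K k)
          (run_y u k.-1) (run_Y u k) (run_gamma u k) (run_y u k)].

Definition xi_star (R : realType) (s N : nat) (M : rk_method R s)
    (S : 'M[R]_N) (dt : R) (YK LamK : 'I_s -> 'cV[R]_N) : R :=
  dt * \sum_i \sum_j rka M j i * dotv (S *m YK i) (LamK j).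

(* One adjoint step from lam to lam' with stages Lam and sources w, W, about a
   forward step of size h that starts at y.  The scalar xs is subtracted from
   xi: it is 0 for the first adjoint step and xi_star for all the others. *)
Definition adjoint_step (R : realType) (s N : nat) (M : rk_method R s)
    (S : 'M[R]_N) (eta : 'cV[R]_N -> R) (h : R) (y : 'cV[R]_N)
    (Y : 'I_s -> 'cV[R]_N) (g xs : R) (w : 'cV[R]_N) (W : 'I_s -> 'cV[R]_N)
    (lam : 'cV[R]_N) (Lam : 'I_s -> 'cV[R]_N) (lam' : 'cV[R]_N) : Prop :=
  let xi := h * \sum_i rkb M i 0 * dotv (S *m Y i) lam in
  (forall i,
      Lam i = h *: (S^T *m ((g * rkb M i 0) *: lam
                            + \sum_j rka M j i *: Lam j))
              + (xi - xs) *: grad_Y_gamma M S eta h g y Y i + W i) /\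
  lam' = lam + \sum_i Lam i + (xi - xs) *: grad_y_gamma M S eta h g y Y + w.

Definition adjoint_step_at (R : realType) (s N : nat) (M : rk_method R s)
    (S : 'M[R]_N) (eta : 'cV[R]_N -> R) (dt T : R) (K : nat)
    (u : rrk_run R s N) (k : nat) (xs : R) (w : 'cV[R]_N)
    (W : 'I_s -> 'cV[R]_N) (lam : 'cV[R]_N) (Lam : 'I_s -> 'cV[R]_N)
    (lam' : 'cV[R]_N) : Prop :=
  adjoint_step M S eta (step_size dt T (run_gamma u) K k)
    (run_y u k.-1) (run_Y u k) (run_gamma u k) xs w W lam Lam lam'.

Definition is_adjoint_rrk_solution (R : realType) (s N : nat)
    (M : rk_method R s) (S : 'M[R]_N) (eta : 'cV[R]_N -> R) (dt T : R)
    (K : nat) (u : rrk_run R s N) (w : nat -> 'cV[R]_N)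
    (W : nat -> 'I_s -> 'cV[R]_N) (lamK : 'cV[R]_N) (lam : nat -> 'cV[R]_N)
    (Lam : nat -> 'I_s -> 'cV[R]_N) : Prop :=
  lam K = lamK /\
  forall k, (1 <= k <= K)%N ->
    adjoint_step_at M S eta dt T K u k
      (if k == K then 0 else xi_star M S dt (run_Y u K) (Lam K))
      (w k.-1) (W k) (lam k) (Lam k) (lam k.-1).

(* Every source-free adjoint step reverses the corresponding forward step:
   started at y_k it can be carried out, and it can only end at y_{k-1}.  The
   steps k < K depend on the first adjoint step through xi_star, so they are
   taken relative to the stages LamK of an adjoint step started at y_K. *)
Definition time_symmetric (R : realType) (s N : nat) (M : rk_method R s)
    (S : 'M[R]_N) (eta : 'cV[R]_N -> R) (dt T : R) (K : nat)
    (u : rrk_run R s N) : Prop :=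
  (forall lam',
     (exists LamK, adjoint_step_at M S eta dt T K u K 0 0 (fun=> 0)
                     (run_y u K) LamK lam')
     <-> lam' = run_y u K.-1) /\
  (forall LamK lamK',
     adjoint_step_at M S eta dt T K u K 0 0 (fun=> 0) (run_y u K) LamK lamK' ->
     forall k, (1 <= k < K)%N -> forall lam',
       (exists Lam, adjoint_step_at M S eta dt T K u k
                      (xi_star M S dt (run_Y u K) LamK) 0 (fun=> 0)
                      (run_y u k) Lam lam')
       <-> lam' = run_y u k.-1).

(* Main.v *)
Require Import Defs.
From HB Require Import structures.
From mathcomp Require Import all_boot all_order all_algebra.
From mathcomp Require Import all_classical all_reals all_analysis.
From mathcomp Require Import ring lra.
Import Order.TTheory GRing.Theory Num.Theory.
Import numFieldNormedType.Exports.
Local Open Scope ring_scope.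

(** Write [F] for the increment [\sum_i b_i S Y_i], [<u, v>] for the Euclidean
    inner product and [y' = y + g h F] for the end of a forward step of size [h].

    Since [S] is skew-symmetric, [<Y, S Y> = 0] for every [Y], so the last term
    of the residual vanishes identically in the stages and
    [r(g; y, Y) = g h <y, F> + (g h)^2 |F|^2 / 2].  The partial derivatives are
    [dr/dg = h <F, y'>], [dr/dy = g h F] and [dr/dY_i = g h b_i S^T y'].  The
    first one is exactly the scalar [xi] of an adjoint step that starts at
    [y'], so [xi] cancels the factor [(dr/dg)^-1] of the implicit gradients of
    [g] ([adjoint_step_from_endE]):

    - the forcing [xi * grad_Y g] of adjoint stage [i] is
      [- g h b_i S^T y'], opposite to the term [h S^T (g b_i y')]: the stages
      solve the homogeneous system [Lam_i = h S^T \sum_j a_ji Lam_j];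
    - [xi * grad_y g = - g h F], so that with vanishing stages the adjoint step
      ends at [y' - g h F = y].

    The homogeneous system has only the zero solution: the tableau is lower
    triangular, so the adjoint stages decouple from the last one backwards, and
    each diagonal block [1 - c S^T] is injective because [<x, S^T x> = 0]
    ([adjoint_stages_homogeneous_eq0]).  In particular the stages of the first
    adjoint step vanish, so [xi_star = 0] and the remaining steps have the same
    form as the first one; each of them undoes its forward step
    ([adjoint_step_reverses]). *)

(** * The Euclidean inner product *)

Section InnerProduct.
Context {R : realType} {N : nat}.
Implicit Types (u v w : 'cV[R]_N) (S : 'M[R]_N).

Lemma dotvE u v : dotv u v = \sum_i u i 0 * v i 0.
Proof. by rewrite /dotv mxE; apply: eq_bigr => i _; rewrite mxE. Qed.

Lemma dotvC u v : dotv u v = dotv v u.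
Proof. by rewrite !dotvE; apply: eq_bigr => i _; rewrite mulrC. Qed.

Lemma dotvDl u v w : dotv (u + v) w = dotv u w + dotv v w.
Proof. by rewrite /dotv linearD mulmxDl mxE. Qed.

Lemma dotvDr u v w : dotv u (v + w) = dotv u v + dotv u w.
Proof. by rewrite /dotv mulmxDr mxE. Qed.

Lemma dotvZl c u v : dotv (c *: u) v = c * dotv u v.
Proof. by rewrite /dotv linearZ -scalemxAl mxE. Qed.

Lemma dotvZr c u v : dotv u (c *: v) = c * dotv u v.
Proof. by rewrite dotvC dotvZl dotvC. Qed.

Lemma dotv_suml (I : finType) (f : I -> 'cV[R]_N) v :
  dotv (\sum_i f i) v = \sum_i dotv (f i) v.
Proof. by rewrite /dotv linear_sum mulmx_suml summxE. Qed.

Lemma dotv0r u : dotv u 0 = 0.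
Proof. by rewrite /dotv mulmx0 mxE. Qed.

Lemma dotv_mulmxl S u v : dotv (S *m u) v = dotv u (S^T *m v).
Proof. by rewrite /dotv trmx_mul mulmxA. Qed.

Lemma dotv_delta i v : dotv (delta_mx i 0) v = v i 0.
Proof.
rewrite dotvE (bigD1 i) //= big1 ?mxE ?eqxx ?mul1r ?addr0 // => j /negPf ji.
by rewrite mxE ji mul0r.
Qed.

Lemma dotv_ge0 u : 0 <= dotv u u.
Proof. by rewrite dotvE sumr_ge0 // => i _; rewrite -expr2 sqr_ge0. Qed.

Lemma dotv_eq0 u : dotv u u = 0 -> u = 0.
Proof.
rewrite dotvE => /eqP; rewrite psumr_eq0; last first.
  by move=> i _; rewrite -expr2 sqr_ge0.
move/allP => u0; apply/colP => i; rewrite mxE.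
by have := u0 i (mem_index_enum _); rewrite -expr2 sqrf_eq0 => /eqP.
Qed.

Lemma skew_dotv0 S u : skew_symmetric S -> dotv u (S *m u) = 0.
Proof.
move=> hS; have : dotv u (S *m u) = - dotv u (S *m u).
  by rewrite {1}dotvC dotv_mulmxl hS mulNmx -scaleN1r dotvZr mulN1r.
lra.
Qed.

(** A real multiple of a skew-symmetric matrix has no eigenvalue 1. *)
Lemma skew_fixed_eq0 S c u : skew_symmetric S -> u = c *: (S^T *m u) -> u = 0.
Proof.
move=> hS uE; apply: dotv_eq0.
by rewrite {2}uE dotvZr -dotv_mulmxl dotvC skew_dotv0 // mulr0.
Qed.

Lemma square_entropyE u : square_entropy u = 2^-1 * dotv u u.
Proof. by rewrite /square_entropy /enorm sqr_sqrtr // dotv_ge0. Qed.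

Lemma square_entropyD u v :
  square_entropy (u + v) = square_entropy u + dotv u v + square_entropy v.
Proof.
by rewrite !square_entropyE !(dotvDl, dotvDr) (dotvC v u); field.
Qed.

Lemma square_entropyZ c u :
  square_entropy (c *: u) = c ^+ 2 * square_entropy u.
Proof. by rewrite !square_entropyE dotvZl dotvZr; ring. Qed.

End InnerProduct.

(** * Derivatives of the relaxation residual *)

(** The residual is quadratic along every line in each of its variables, so
    all its derivatives can be read off such expansions. *)
Lemma derive_quadratic {R : realType} {V : normedModType R} (f : V -> R)
    (x v : V) (a b : R) :
  (forall t, f (t *: v + x) = f x + t * a + t ^+ 2 * b) -> 'D_v f x = a.
Proof.
move=> fE; apply/cvg_lim => //.
have lin : ((fun t : R => a + t * b) @ 0^' --> a)%classic.
  rewrite -[X in (_ --> X)%classic]addr0 -[X in (_ --> _ + X)%classic](mul0r b).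
  apply: cvgD; first exact: cvg_cst.
  apply: (@cvgM _ _ _ _ (fun t : R => t)); last exact: cvg_cst.
  exact: cvg_within.
apply: cvg_trans lin; apply: near_eq_cvg; near=> t.
have t0 : t != 0 by near: t; exact: nbhs_dnbhs_neq.
by rewrite /= fE /GRing.scale /=; field.
Unshelve. all: by end_near.
Qed.

Lemma grad_quadratic {R : realType} {N : nat} (f : 'cV[R]_N -> R)
    (x c : 'cV[R]_N) (q : 'cV[R]_N -> R) :
  (forall t v, f (t *: v + x) = f x + t * dotv v c + t ^+ 2 * q v) ->
  grad f x = c.
Proof.
move=> fE; apply/colP => i; rewrite mxE.
by rewrite (derive_quadratic _ _ _ _ _ (fun t => fE t _)) dotv_delta.
Qed.

Lemma grad_square_entropy {R : realType} {N : nat} (x : 'cV[R]_N) :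
  grad (@square_entropy R N) x = x.
Proof.
apply: (@grad_quadratic _ _ _ _ _ (@square_entropy R N)) => t v.
by rewrite square_entropyD square_entropyZ dotvZl; ring.
Qed.

Section Step.
Context {R : realType} {s N : nat} {M : rk_method R s} {S : 'M[R]_N}.
Hypothesis hS : skew_symmetric S.
Implicit Types (h g : R) (y lam : 'cV[R]_N) (Y Lam : 'I_s -> 'cV[R]_N).
Local Notation F := (rk_increment M S).
Local Notation eta := (@square_entropy R N).

Lemma relax_residualE h g y Y :
  relax_residual M S eta h g y Y =
  g * h * dotv y (F Y) + (g * h) ^+ 2 * square_entropy (F Y).
Proof.
rewrite /relax_residual big1 => [|i _].
  by rewrite square_entropyD square_entropyZ dotvZr; ring.
by rewrite grad_square_entropy skew_dotv0 // mulr0.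
Qed.

(** The factorisation through the end point of the step is what makes this
    derivative agree with the scalar [xi] of the adjoint step. *)
Lemma relax_residual_dgammaE h g y Y :
  relax_residual_dgamma M S eta h g y Y =
  h * dotv (F Y) (y + (g * h) *: F Y).
Proof.
rewrite /relax_residual_dgamma derive1E.
apply: (@derive_quadratic _ _ _ _ _ _ (h ^+ 2 * square_entropy (F Y))) => t.
rewrite !relax_residualE square_entropyE dotvDr dotvZr (dotvC (F Y) y).
by rewrite /GRing.scale /=; field.
Qed.

Lemma grad_y_relax_residual h g y Y :
  grad (fun z => relax_residual M S eta h g z Y) y = (g * h) *: F Y.
Proof.
apply: (@grad_quadratic _ _ _ _ _ (fun=> 0)) => t v.
by rewrite !relax_residualE dotvDl dotvZl dotvZr; ring.
Qed.

Lemma rk_increment_update Y i t v :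
  F (fun j => if j == i then t *: v + Y i else Y j) =
  F Y + (t * rkb M i 0) *: (S *m v).
Proof.
rewrite /rk_increment (bigD1 i) //= [in RHS](bigD1 i) //= eqxx.
rewrite (eq_bigr (fun j => rkb M j 0 *: (S *m Y j))) => [|j /negPf -> //].
rewrite mulmxDr scalerDr -scalemxAr scalerA (mulrC t) [RHS]addrAC.
by congr (_ + _); rewrite addrC.
Qed.

Lemma grad_Y_relax_residual h g y Y i :
  grad (fun z => relax_residual M S eta h g y
                   (fun j => if j == i then z else Y j)) (Y i) =
  (g * h * rkb M i 0) *: (S^T *m (y + (g * h) *: F Y)).
Proof.
apply: (@grad_quadratic _ _ _ _ _
  (fun v => (g * h * rkb M i 0) ^+ 2 * square_entropy (S *m v))) => t v.
have YE : (fun j => if j == i then Y i else Y j) = Y.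
  by apply/funext => j; case: eqP => [->|].
rewrite YE !relax_residualE rk_increment_update square_entropyD.
rewrite square_entropyZ dotvDr !dotvZr -dotv_mulmxl dotvDr dotvZr.
by rewrite (dotvC (S *m v) y) (dotvC (S *m v)); ring.
Qed.

(** * Adjoint steps *)

(** The tableau is transposed in the adjoint stages, so that stage [i] is
    coupled to the stages after it only. *)
Lemma adjoint_stages_homogeneous_eq0 {h Lam} :
  rk_lower_triangular M ->
  (forall i, Lam i = h *: (S^T *m (\sum_j rka M j i *: Lam j))) ->
  forall i, Lam i = 0.
Proof.
move=> hM LamE i; have [n] := ubnP (s - i).
elim: n i => // n IHn i lt_n.
apply: (@skew_fixed_eq0 _ _ S (h * rka M i i) _ hS).
rewrite {1}LamE (bigD1 i) //= big1 ?addr0 => [|j ji].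
  by rewrite -scalemxAr scalerA.
have [lt_ji|lt_ij|/val_inj eq_ji] := ltngtP j i.
- by rewrite hM // scale0r.
- rewrite IHn ?scaler0 //; apply: leq_trans (ltn_sub2l _ lt_ij) _ => //.
- by rewrite eq_ji eqxx in ji.
Qed.

(** The relaxation gradients cancel the explicit dependence of the stages on
    the starting value, and replace it by [y] in the final update. *)
Lemma adjoint_step_from_endE h g y Y Lam lam' :
  relax_residual_dgamma M S eta h g y Y != 0 ->
  adjoint_step M S eta h y Y g 0 0 (fun=> 0) (y + (g * h) *: F Y) Lam lam' <->
  (forall i, Lam i = h *: (S^T *m (\sum_j rka M j i *: Lam j))) /\
  lam' = y + \sum_i Lam i.
Proof.
move=> D0; rewrite /adjoint_step subr0.
set y' := y + _.
have -> : h * (\sum_i rkb M i 0 * dotv (S *m Y i) y') =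
          relax_residual_dgamma M S eta h g y Y.
  rewrite relax_residual_dgammaE dotv_suml; congr (_ * _).
  by apply: eq_bigr => i _; rewrite dotvZl.
rewrite /grad_Y_gamma /grad_y_gamma grad_y_relax_residual.
set D := relax_residual_dgamma _ _ _ _ _ _ _ in D0 *.
have cancelD v : D *: (- D^-1 *: v) = - v.
  by rewrite scalerA mulrN divff // scaleN1r.
have -> : y' + \sum_i Lam i + D *: (- D^-1 *: ((g * h) *: F Y)) + 0 =
          y + \sum_i Lam i.
  by rewrite cancelD addr0 /y' addrAC addrK.
have stE i : h *: (S^T *m ((g * rkb M i 0) *: y' + \sum_j rka M j i *: Lam j))
    + D *: (- D^-1 *: grad (fun z => relax_residual M S eta h g y
                   (fun j => if j == i then z else Y j)) (Y i)) + 0 =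
    h *: (S^T *m (\sum_j rka M j i *: Lam j)).
  rewrite cancelD grad_Y_relax_residual -/y' addr0 mulmxDr scalerDr.
  by rewrite -scalemxAr scalerA mulrCA mulrA addrAC subrr add0r.
by split=> -[LamE ->]; split=> // i; have := LamE i; rewrite stE.
Qed.

Lemma adjoint_step_reverses {h g y Y y'} Lam lam' :
  rk_lower_triangular M -> rrk_step M S eta h y Y g y' ->
  adjoint_step M S eta h y Y g 0 0 (fun=> 0) y' Lam lam' <->
  (forall i, Lam i = 0) /\ lam' = y.
Proof.
move=> hM [_ _ D0 ->]; rewrite adjoint_step_from_endE //.
split=> [[LamE ->]|[Lam0 ->]].
  have Lam0 := adjoint_stages_homogeneous_eq0 hM LamE.
  by split=> //; rewrite big1 ?addr0.
split=> [i|]; last by rewrite big1 ?addr0.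
by rewrite Lam0 big1 ?mulmx0 ?scaler0 // => j _; rewrite Lam0 scaler0.
Qed.

(** The zero stages solve the adjoint step, so it can always be carried out. *)
Lemma adjoint_step_end {h g y Y y'} lam' :
  rk_lower_triangular M -> rrk_step M S eta h y Y g y' ->
  (exists Lam, adjoint_step M S eta h y Y g 0 0 (fun=> 0) y' Lam lam') <->
  lam' = y.
Proof.
move=> hM stp; split=> [[Lam]|->].
  by move/(adjoint_step_reverses _ _ hM stp) => [].
by exists (fun=> 0); apply/(adjoint_step_reverses _ _ hM stp).
Qed.

Lemma xi_star0 h Y Lam : (forall i, Lam i = 0) -> xi_star M S h Y Lam = 0.
Proof.
move=> Lam0; rewrite /xi_star big1 ?mulr0 // => i _.
by rewrite big1 // => j _; rewrite Lam0 dotv0r mulr0.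
Qed.

End Step.

Theorem theorem4 (R : realType) (s N : nat) (M : rk_method R s)
    (S : 'M[R]_N) (dt T : R) (K : nat) (yinit : 'cV[R]_N)
    (u : rrk_run R s N)
    (hS : skew_symmetric S)
    (hM : rk_lower_triangular M)
    (hdt : 0 < dt) (hT : 0 < T) (hK : (0 < K)%N)
    (hu : is_rrk_solution M S (@square_entropy R N) dt T K yinit u) :
  time_symmetric M S (@square_entropy R N) dt T K u /\
  (forall (lam : nat -> 'cV[R]_N) (Lam : nat -> 'I_s -> 'cV[R]_N),
     is_adjoint_rrk_solution M S (@square_entropy R N) dt T K u
       (fun=> 0) (fun _ _ => 0) (run_y u K) lam Lam ->
     forall k, (k <= K)%N -> lam k = run_y u k).
Proof.
have [_ _ stp] := hu.
have stpK := stp K; rewrite hK leqnn in stpK; have {}stpK := stpK isT.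
split.
  split=> [lam'|LamK lamK' /(adjoint_step_reverses hS _ _ hM stpK) [LamK0 _]].
    exact (adjoint_step_end hS lam' hM stpK).
  move=> k /andP[k1 kK] lam'; rewrite xi_star0 //.
  by apply: (adjoint_step_end hS lam' hM); apply: stp; rewrite k1 ltnW.
move=> lam Lam [lamK adj].
have LamK0 : forall i, Lam K i = 0.
  have := adj K; rewrite hK leqnn eqxx lamK => /(_ isT).
  by move/(adjoint_step_reverses hS _ _ hM stpK) => [].
have back k : (k < K)%N -> lam k.+1 = run_y u k.+1 -> lam k = run_y u k.
  move=> kK lamE; have := adj k.+1 kK; rewrite xi_star0 // if_same lamE.
  by move/(adjoint_step_reverses hS _ _ hM (stp k.+1 kK)) => [].
suff down m : (m <= K)%N -> lam (K - m)%N = run_y u (K - m)%N.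
  by move=> k kK; rewrite -(subKn kK); apply: down; rewrite leq_subr.
elim: m => [|m IHm] mK; first by rewrite subn0.
by apply: back; rewrite subnSK ?leq_subr // IHm // ltnW.
Qed.
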